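(* Let $X$ be an hls-space. Then the following are equivalent: (1) $X$ is hls-normal; (2) whenever $A\subseteq X$ has hybrid neighbourhood $N$, there is a continuous slowly oscillating map $f: X \rightarrow [0,1]$ such that $f(A) \subseteq \{0\}$ and $f(X \setminus N) \subseteq \{1\}$; (3) for any closed, coarsely separated, disjoint subsets $A$ and $B$ of $X$ there is a continuous slowly oscillating map $f: X \rightarrow [0,1]$ such that $f(A) \subseteq \{0\}$ and $f(B) \subseteq \{1\}$.
   Context: For $B\subseteq X$ and a family $\mathcal{U}$ of subsets of $X$, $\mathrm{st}(B,\mathcal{U})$ is the union of the elements of $\mathcal{U}$ meeting $B$; for a family $\mathcal{B}$, $\mathrm{st}(\mathcal{B},\mathcal{U})=\{\mathrm{st}(B,\mathcal{U})\mid B\in\mathcal{B}\}$. A large scale structure (ls-structure) on a set $X$ is a nonempty collection $\mathcal{L}$ of families of subsets of $X$ (the uniformly bounded families) such that: (i) if $\mathcal{B}_1\in\mathcal{L}$ and each element of $\mathcal{B}_2$ having more than one point is contained in some element of $\mathcal{B}_1$, then $\mathcal{B}_2\in\mathcal{L}$; (ii) $\mathcal{B}_1,\mathcal{B}_2\in\mathcal{L}$ implies $\mathrm{st}(\mathcal{B}_1,\mathcal{B}_2)\in\mathcal{L}$. An ls-space is a set with an ls-structure. A hybrid large scale space (hls-space) is a set with an ls-structure and a topology such that some uniformly bounded cover consists of open sets. A subset is bounded if it is an element of some uniformly bounded cover. The coarse component of a point $x$ is the union of all bounded sets containing $x$. A subset is weakly bounded if its intersection with every coarse component is bounded. A map $f:X\to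 M$ to a metric space is slowly oscillating if for every uniformly bounded family $\mathcal{U}$ and every $\varepsilon>0$ there is a weakly bounded set $K$ such that $\mathrm{diam}(f(U))<\varepsilon$ for every $U\in\mathcal{U}$ with $U\cap K=\varnothing$. Subsets $A,B$ are coarsely separated if $\mathrm{st}(A,\mathcal{U})\cap\mathrm{st}(B,\mathcal{U})$ is weakly bounded for every uniformly bounded family $\mathcal{U}$. $N$ is a coarse neighbourhood of $A$ if $A\subseteq N$ and for every uniformly bounded cover $\mathcal{U}$, $\mathrm{st}(A,\mathcal{U})\subseteq N\cup K$ for some weakly bounded $K$. $N$ is a topological neighbourhood of $A$ if $N$ contains an open set containing $\mathrm{cl}(A)$. $N$ is a hybrid neighbourhood of $A$ if it is both a topological and a coarse neighbourhood of $A$. An hls-space $X$ is hls-normal if for every closed $A\subseteq X$ and every hybrid neighbourhood $N$ of $A$ there is a closed $V\subseteq X$ such that $V$ is a hybrid neighbourhood of $A$ and $N$ is a hybrid neighbourhood of $V$. *)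

(* Defs.v *)
From HB Require Import structures.
From mathcomp Require Import all_boot all_order all_algebra.
From mathcomp Require Import all_classical all_reals all_analysis.

Set Implicit Arguments.
Unset Strict Implicit.
Unset Printing Implicit Defensive.

Import Order.TTheory GRing.Theory Num.Theory.
Import numFieldNormedType.Exports.

Local Open Scope classical_set_scope.
Local Open Scope ring_scope.

Definition star (X : Type) (B : set X) (U : set (set X)) : set X :=
  \bigcup_(C in [set C | U C /\ C `&` B !=set0]) C.

Definition star_family (X : Type) (Bs U : set (set X)) : set (set X) :=
  [set star B U | B in Bs].

Record ls_structure (X : Type) := LsStructure {
  unif_bounded : set (set (set X));
  unif_bounded_neq0 : unif_bounded !=set0;
  unif_bounded_refine : forall B1 B2 : set (set X),
    unif_bounded B1 ->
    (forall B, B2 B -> (exists x y, [/\ B x, B y & x <> y]) ->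
       exists2 C, B1 C & B `<=` C) ->
    unif_bounded B2;
  unif_bounded_star : forall B1 B2 : set (set X),
    unif_bounded B1 -> unif_bounded B2 -> unif_bounded (star_family B1 B2)
}.

Section large_scale.
Context (X : Type) (L : ls_structure X).

Definition unif_bounded_cover (U : set (set X)) : Prop :=
  unif_bounded L U /\ \bigcup_(B in U) B = [set: X].

Definition ls_bounded (B : set X) : Prop :=
  exists2 U, unif_bounded_cover U & U B.

Definition coarse_component (x : X) : set X :=
  \bigcup_(B in [set B | ls_bounded B /\ B x]) B.

Definition weakly_bounded (K : set X) : Prop :=
  forall x, ls_bounded (K `&` coarse_component x).

Definition coarsely_separated (A B : set X) : Prop :=
  forall U, unif_bounded L U -> weakly_bounded (star A U `&` star B U).

Definition coarse_nbhd (A N : set X) : Prop :=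
  A `<=` N /\
  forall U, unif_bounded_cover U ->
    exists2 K, weakly_bounded K & star A U `<=` N `|` K.

End large_scale.

(* The maximum with 0 only matters for the empty set, where the supremum in the
   extended reals is -oo. *)
Definition diam (R : realType) (M : metricType R) (A : set M) : \bar R :=
  maxe 0%E (ereal_sup [set (mdist p.1 p.2)%:E | p in A `*` A]).

Definition slowly_oscillating (X : Type) (L : ls_structure X)
    (R : realType) (M : metricType R) (f : X -> M) : Prop :=
  forall U, unif_bounded L U -> forall e : R, 0 < e ->
    exists2 K, weakly_bounded L K &
      forall B, U B -> B `&` K = set0 -> (diam (f @` B) < e%:E)%E.

Record hls_structure (X : topologicalType) := HlsStructure {
  hls_ls :> ls_structure X;
  hls_open_cover :
    exists2 U, unif_bounded_cover hls_ls U & (forall B, U B -> open B)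
}.

Definition topological_nbhd (X : topologicalType) (A N : set X) : Prop :=
  exists W : set X, [/\ open W, closure A `<=` W & W `<=` N].

Section hybrid.
Context (X : topologicalType) (L : hls_structure X).

Definition hybrid_nbhd (A N : set X) : Prop :=
  topological_nbhd A N /\ coarse_nbhd L A N.

Definition hls_normal : Prop :=
  forall A N : set X, closed A -> hybrid_nbhd A N ->
    exists V : set X, [/\ closed V, hybrid_nbhd A V & hybrid_nbhd V N].

End hybrid.

(* Maps into [0,1] are represented as real-valued maps with range in [0,1]; as
   [0,1] carries the metric induced from R, this changes neither continuity nor
   slow oscillation. *)
Definition separating_map (X : topologicalType) (L : hls_structure X)
    (R : realType) (A B : set X) (f : X -> R^o) : Prop :=
  [/\ continuous f,
      slowly_oscillating L f,
      (forall x, 0 <= f x <= 1),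
      f @` A `<=` [set 0]
    & f @` B `<=` [set 1]].

(* Main.v *)
(** The implication from (1) to (2) is Urysohn's argument: normality interpolates
    a family of sets V_{k/2^n}, each a hybrid neighbourhood of the previous one,
    between the closure of A and N, and f(x) is the infimum of the dyadic r with
    x in V_r. The topological half of "hybrid" gives continuity; the coarse half
    gives slow oscillation, since at level n only the 2^n steps
    st(V_{k/2^n}, U) inside V_{(k+1)/2^n} matter, and the union of their
    finitely many weakly bounded exceptional sets is weakly bounded.
    Passing to closures is harmless for coarse notions because
    cl(A) is contained in st(A, O) for a uniformly bounded open cover O; hence N
    is a coarse neighbourhood of A iff A is coarsely separated from the closure
    of X \ N, which links (2) and (3). From (3), the set {f <= 1/2} interpolates
    between A and N. *)

Require Import Defs.
From mathcomp Require Import all_boot all_order all_algebra.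
From mathcomp Require Import all_classical all_reals all_analysis.
From mathcomp Require Import lra.

Set Implicit Arguments.
Unset Strict Implicit.
Unset Printing Implicit Defensive.

Import Order.TTheory GRing.Theory Num.Theory.
Import numFieldNormedType.Exports.

Local Open Scope classical_set_scope.
Local Open Scope ring_scope.

(** * Stars and iterated stars *)

Lemma star_mono (X : Type) (A B : set X) (U W : set (set X)) :
  A `<=` B -> U `<=` W -> star A U `<=` star B W.
Proof.
move=> AB UW x [C [UC [y [Cy Ay]]] Cx].
by exists C => //; split; [exact: UW|exists y; split => //; exact: AB].
Qed.

Lemma sub_star (X : Type) (A : set X) (U : set (set X)) :
  \bigcup_(B in U) B = [set: X] -> A `<=` star A U.
Proof.
move=> Ucov x Ax; have [C UC Cx] : (\bigcup_(B in U) B) x by rewrite Ucov.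
by exists C => //; split => //; exists x.
Qed.

(** A member of [W] meeting some [C] in [U] lies in [star C W]; since [W] covers, [star C W]
    contains [C] and so still meets [A]. *)
Lemma star_star (X : Type) (A : set X) (U W : set (set X)) :
  \bigcup_(B in W) B = [set: X] ->
  star (star A U) W `<=` star A (star_family U W).
Proof.
move=> Wcov x [D [WD [y [Dy [C [UC [a [Ca Aa]]] Cy]]]] Dx].
exists (star C W); last by exists D => //; split => //; exists y.
split; first by exists C.
by exists a; split => //; exact: (sub_star Wcov).
Qed.

(** * Bounded sets, weakly bounded sets and coarse neighbourhoods *)

Section large_scale_spaces.
Context (X : Type) (L : ls_structure X).

(** Refinement ignores one-point sets, so adding all singletons is free. This lets cover-based
    definitions be applied to arbitrary uniformly bounded families. *)
Lemma unif_bounded_points (U : set (set X)) :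
  unif_bounded L U -> unif_bounded_cover L (U `|` range set1).
Proof.
move=> LU; split; last first.
  by apply/seteqP; split => // x _; exists [set x] => //; right; exists x.
apply: (unif_bounded_refine LU) => B [UB _|[z _ <-] [x [y [-> ->]]]//].
by exists B.
Qed.

Lemma unif_bounded_star_family_cover (U W : set (set X)) :
  unif_bounded_cover L U -> unif_bounded_cover L W ->
  unif_bounded_cover L (star_family U W).
Proof.
move=> [LU Ucov] [LW Wcov]; split; first exact: unif_bounded_star.
apply/seteqP; split => // x _.
have [C UC Cx] : (\bigcup_(B in U) B) x by rewrite Ucov.
by exists (star C W); [exists C|exact: (sub_star Wcov)].
Qed.

Lemma ls_bounded_in (U : set (set X)) (B : set X) :
  unif_bounded L U -> U B -> ls_bounded L B.
Proof.
by move=> /unif_bounded_points LU UB; exists (U `|` range set1) => //; left.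
Qed.

Lemma ls_bounded_sub (A B : set X) :
  A `<=` B -> ls_bounded L B -> ls_bounded L A.
Proof.
move=> AB [U [LU _] UB]; apply: (@ls_bounded_in [set A]) => //.
by apply: (unif_bounded_refine LU) => _ -> _; exists B.
Qed.

Lemma ls_bounded_star (B : set X) (U : set (set X)) :
  unif_bounded L U -> ls_bounded L B -> ls_bounded L (star B U).
Proof.
move=> LU [W [LW _] WB].
by apply: (ls_bounded_in (unif_bounded_star LW LU)); exists B.
Qed.

(** If [B] belongs to the cover [W], the common point makes [B] part of [star A W], which also
    contains [A]. *)
Lemma ls_bounded_join (A B : set X) (x : X) : A x -> B x ->
  ls_bounded L A -> ls_bounded L B -> ls_bounded L (A `|` B).
Proof.
move=> Ax Bx LA [W [LW Wcov] WB].
apply: (ls_bounded_sub _ (ls_bounded_star LW LA)) => y [Ay|By].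
  exact: (sub_star Wcov).
by exists B => //; split => //; exists x.
Qed.

Lemma coarse_component_trans (x y : X) (B : set X) :
  ls_bounded L B -> B y -> coarse_component L x y ->
  B `<=` coarse_component L x.
Proof.
move=> LB By [C [LC Cx] Cy] z Bz; exists (C `|` B); last by right.
by split; [exact: (ls_bounded_join Cy By)|left].
Qed.

Lemma weakly_bounded_sub (A B : set X) :
  A `<=` B -> weakly_bounded L B -> weakly_bounded L A.
Proof. by move=> AB wB x; apply: ls_bounded_sub (wB x); exact: setSI. Qed.

Lemma weakly_bounded0 : weakly_bounded L set0.
Proof.
move=> x; have [U LU] := unif_bounded_neq0 L.
apply: (@ls_bounded_sub _ [set x]); first by move=> ? [].
by exists (U `|` range set1); [exact: unif_bounded_points|right; exists x].
Qed.

(** Bounded sets may be joined only through a common point. When both traces on the component of [x]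
    are nonempty, each is linked to [x] by a bounded set, and the two enlarged sets share [x]. *)
Lemma weakly_boundedU (A B : set X) :
  weakly_bounded L A -> weakly_bounded L B -> weakly_bounded L (A `|` B).
Proof.
move=> wA wB x; rewrite setIUl.
have [->|/set0P[a Aa]] := eqVneq (A `&` coarse_component L x) set0.
  by rewrite set0U.
have [->|/set0P[b Bb]] := eqVneq (B `&` coarse_component L x) set0.
  by rewrite setU0.
have [_ [C [LC Cx] Ca]] := Aa; have [_ [D [LD Dx] Db]] := Bb.
have h1 := ls_bounded_join Aa Ca (wA x) LC.
have h2 := ls_bounded_join Bb Db (wB x) LD.
have hx := ls_bounded_join (or_intror Cx) (or_intror Dx) h1 h2.
apply: ls_bounded_sub hx.
by move=> y [?|?]; [left; left|right; left].
Qed.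

Lemma weakly_bounded_bigcup (n : nat) (K : nat -> set X) :
  (forall k, (k < n)%N -> weakly_bounded L (K k)) ->
  weakly_bounded L (\bigcup_(k < n) K k).
Proof.
elim: n => [_|n IH wK].
  by rewrite bigcup_mkord big_ord0; exact: weakly_bounded0.
rewrite bigcup_mkord big_ord_recr /= -bigcup_mkord.
by apply: weakly_boundedU; [apply: IH => k kn; apply: wK; exact: ltnW|exact: wK].
Qed.

(** A member of [U] meeting the component of [x] lies inside it, so the trace of [star K U] there
    comes from the trace of [K]. *)
Lemma weakly_bounded_star (K : set X) (U : set (set X)) :
  unif_bounded L U -> weakly_bounded L K -> weakly_bounded L (star K U).
Proof.
move=> LU wK x; apply: (ls_bounded_sub _ (ls_bounded_star LU (wK x))).
move=> y [[C [UC [k [Ck Kk]]] Cy] xy]; exists C => //; split => //.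
exists k; split => //; split => //.
exact: (coarse_component_trans (ls_bounded_in LU UC) Cy xy).
Qed.

Lemma coarse_nbhd_star (A N : set X) (U : set (set X)) :
  coarse_nbhd L A N -> unif_bounded L U ->
  exists2 K, weakly_bounded L K & star A U `<=` N `|` K.
Proof.
move=> [_ AN] /unif_bounded_points/AN[K wK AK]; exists K => //.
by apply: subset_trans AK; apply: star_mono => // B; left.
Qed.

Lemma coarsely_separated_nbhd (A B : set X) :
  coarsely_separated L A B -> A `&` B = set0 -> coarse_nbhd L A (~` B).
Proof.
move=> sAB AB0; split; first by rewrite -disjoints_subset.
move=> U [LU Ucov]; exists (star A U `&` star B U); first exact: sAB.
move=> x sx; have [Bx|] := pselect (B x); last by left.
by right; split => //; exact: (sub_star Ucov).
Qed.

(** If [x] is in both stars, a member of [U] joins [x] to some [y] outside [N]. This [y] lies in an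
    iterated star of [A], hence in the exceptional set [K], and [x] lies in [star K U]. *)
Lemma coarse_nbhd_separated (A N : set X) :
  coarse_nbhd L A N -> coarsely_separated L A (~` N).
Proof.
move=> AN U LU; have [LU' Ucov] := unif_bounded_points LU.
have [K wK AK] := coarse_nbhd_star AN (unif_bounded_star LU' LU').
apply: (weakly_bounded_sub _ (weakly_bounded_star LU wK)).
move=> x [Ax [C [UC [y [Cy Ny]]] Cx]].
have : star A (star_family (U `|` range set1) (U `|` range set1)) y.
  apply: (star_star Ucov); exists C => //; split; first by left.
  by exists x; split => //; apply: star_mono Ax => // B; left.
by move=> /AK[//|Ky]; exists C => //; split => //; exists y.
Qed.

End large_scale_spaces.

(** * Closures at large scale *)

Lemma closure_sub_star (X : topologicalType) (A : set X) (U : set (set X)) :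
  \bigcup_(B in U) B = [set: X] -> (forall B, U B -> open B) ->
  closure A `<=` star A U.
Proof.
move=> Ucov Uopen x clAx.
have [C UC Cx] : (\bigcup_(B in U) B) x by rewrite Ucov.
exists C => //; split => //.
by have [y [Ay Cy]] := clAx C (open_nbhs_nbhs (conj (Uopen _ UC) Cx)); exists y.
Qed.

Section hybrid_spaces.
Context (X : topologicalType) (L : hls_structure X).

(** [G] is the open cover of the hybrid structure, for which [closure A] is inside [star A G]. *)
Lemma star_closure : exists2 G, unif_bounded_cover L G &
  forall (A : set X) U, \bigcup_(B in U) B = [set: X] ->
    star (closure A) U `<=` star A (star_family G U).
Proof.
have [G [LG Gcov] Gopen] := hls_open_cover L; exists G => // A U Ucov.
apply: subset_trans (star_star Ucov); apply: star_mono => //.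
exact: closure_sub_star.
Qed.

Lemma coarsely_separated_closurer (A B : set X) :
  coarsely_separated L A B -> coarsely_separated L A (closure B).
Proof.
move=> sAB U LU; have [G LG starG] := star_closure.
have [LU' Ucov] := unif_bounded_points LU.
have subU : U `<=` U `|` range set1 by move=> ? ?; left.
apply: weakly_bounded_sub (sAB _ (unif_bounded_star LG.1 LU')).
apply: setISS; apply: subset_trans (starG _ _ Ucov); apply: star_mono => //.
exact: subset_closure.
Qed.

Lemma hybrid_nbhd_closurel (A N : set X) :
  hybrid_nbhd L A N -> hybrid_nbhd L (closure A) N.
Proof.
move=> [[W [oW AW WN]] AN]; split.
  by exists W; rewrite -(iffLR (closure_id _) (@closed_closure _ A)).
split; first exact: subset_trans WN.
move=> U [LU Ucov]; have [G LG starG] := star_closure.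
have [K wK AK] := coarse_nbhd_star AN (unif_bounded_star LG.1 LU).
by exists K => //; apply: subset_trans AK; exact: starG.
Qed.

End hybrid_spaces.

(** * The Urysohn function of a dyadic chain *)

Section urysohn.
(** [V n k] stands for the set of index k/2^n. The last set of a level is not assumed closed,
    because in the application it is [N]. *)
Context (R : realType) (X : topologicalType) (L : hls_structure X)
  (V : nat -> nat -> set X)
  (V_refine : forall n k, (k <= 2 ^ n)%N -> V n.+1 k.*2 = V n k)
  (V_closed : forall n k, (k < 2 ^ n)%N -> closed (V n k))
  (V_nbhd : forall n k, (k < 2 ^ n)%N -> hybrid_nbhd L (V n k) (V n k.+1)).

Let chain_mono n i j : (i <= j <= 2 ^ n)%N -> V n i `<=` V n j.
Proof.
move=> /andP[]; elim: j => [|j IH]; first by rewrite leqn0 => /eqP -> _.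
rewrite leq_eqVlt => /predU1P[-> _ //|ij jn].
apply: subset_trans (IH ij (ltnW jn)) _.
by have [_ []] := V_nbhd jn.
Qed.

Let chain_refine m n k : (k <= 2 ^ n)%N -> V (n + m) (k * 2 ^ m) = V n k.
Proof.
move=> kn; elim: m => [|m IH]; first by rewrite addn0 muln1.
rewrite addnS expnS mulnCA mul2n V_refine ?IH//.
by rewrite expnD leq_mul2r kn orbT.
Qed.

(** Adjoining 1 keeps the infimum over a nonempty set and gives the value 1 outside the whole
    chain. *)
Definition dyadic_height (x : X) : R^o :=
  inf (1 |` [set r : R | exists n k,
    [/\ (k <= 2 ^ n)%N, V n k x & r = k%:R / 2 ^+ n]]).

Let height_lbound x : has_lbound (1 |` [set r : R | exists n k,
    [/\ (k <= 2 ^ n)%N, V n k x & r = k%:R / 2 ^+ n]]).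
Proof. by exists 0 => r [->//|[n [k [_ _ ->]]]]; rewrite divr_ge0. Qed.

Let height_le1 x : dyadic_height x <= 1.
Proof. by apply: ge_inf; [exact: height_lbound|left]. Qed.

Let height_le n k x : (k <= 2 ^ n)%N -> V n k x ->
  dyadic_height x <= k%:R / 2 ^+ n.
Proof.
move=> kn Vx; apply: ge_inf; first exact: height_lbound.
by right; exists n, k.
Qed.

(** An index j/2^m below k/2^n with [x] in [V m j] would, at the common level [n + m], put [x] in
    [V n k] by monotonicity. *)
Let height_ge n k x : (k <= 2 ^ n)%N -> ~ V n k x ->
  k%:R / 2 ^+ n <= dyadic_height x.
Proof.
move=> kn nVx; apply: lb_le_inf; first by exists 1; left.
move=> r [->|[m [j [jm Vj ->]]]].
  by rewrite ler_pdivrMr ?exprn_gt0// mul1r -natrX ler_nat.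
rewrite leNgt; apply/negP => jk; apply: nVx.
rewrite -(chain_refine m) // addnC.
apply: (@chain_mono _ (j * 2 ^ n)%N); last by rewrite chain_refine.
rewrite addnC expnD leq_mul2r kn orbT andbT.
rewrite -(ler_nat R) !natrM !natrX; apply: ltW.
by move: jk; rewrite ltr_pdivrMr ?exprn_gt0// mulrAC ltr_pdivlMr ?exprn_gt0.
Qed.

Let height_ge0 x : 0 <= dyadic_height x.
Proof.
apply: lb_le_inf; first by exists 1; left.
by move=> r [->//|[n [k [_ _ ->]]]]; rewrite divr_ge0.
Qed.

(** The disjunctions treat the chain as empty below index 0 and as all of [X] at index 2^n, so every
    point has a step; [k] is the least index satisfying the last clause. *)
Let bracket n x : exists k, [/\ (k < 2 ^ n)%N, k = 0%N \/ ~ V n k x &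
  k.+1 = (2 ^ n)%N \/ V n k.+1 x].
Proof.
pose P k := `[< k.+1 = (2 ^ n)%N \/ V n k.+1 x >].
have exP : exists k, P k.
  by exists (2 ^ n).-1; apply/asboolP; left; rewrite prednK ?expn_gt0.
have kP := ex_minnP exP; case: kP => k /asboolP Pk kmin.
have kn : (k <= (2 ^ n).-1)%N.
  by apply: kmin; apply/asboolP; left; rewrite prednK ?expn_gt0.
have {}kn : (k < 2 ^ n)%N by rewrite -[X in (_ < X)%N]prednK ?expn_gt0// ltnS.
exists k; split => //; case: k => [|k] in Pk kmin kn *; first by left.
right=> Vx; suff : (k < k)%N by rewrite ltnn.
by apply: kmin; apply/asboolP; right.
Qed.

Let height_lower n k x : (k < 2 ^ n)%N -> k = 0%N \/ ~ V n k x ->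
  k%:R / 2 ^+ n <= dyadic_height x.
Proof.
by move=> kn [->|nV]; [rewrite mul0r|exact: (height_ge (ltnW kn))].
Qed.

Let height_upper n k x : (k < 2 ^ n)%N -> k.+1 = (2 ^ n)%N \/ V n k.+1 x ->
  dyadic_height x <= k.+1%:R / 2 ^+ n.
Proof.
move=> kn [kE|Vx]; last exact: height_le.
by rewrite kE natrX divff ?expf_neq0.
Qed.

Let mesh (e : R) : 0 < e -> exists n, (2 ^+ n)^-1 *+ 2 < e.
Proof.
move=> e0; have e2 : 0 < e / 2 by rewrite divr_gt0.
have [n _ /(_ n (leqnn n))] := near_infty_natSinv_expn_lt (PosNum e2).
by rewrite /= div1r ltr_pdivlMr// mulr_natr; exists n.
Qed.

Lemma dyadic_height_continuous : continuous dyadic_height.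
Proof.
move=> x; apply/cvgrPdist_le => e /mesh[n ne].
have [k [kn lo up]] := bracket n x.
have xlo := height_lower kn lo; have xup := height_upper kn up.
have n0 : 0 < (2 ^+ n : R)^-1 by rewrite invr_gt0 exprn_gt0.
have near_lo : \forall y \near x, k = 0%N \/ ~ V n k y.
  case: lo => [k0|nVx]; first by apply: nearW => y; left.
  have : open_nbhs x (~` V n k) by split => //; rewrite openC; exact: V_closed.
  by move=> /open_nbhs_nbhs; apply: filterS => y; right.
(* Membership in [V n k.+1] need not persist near [x], but the open set between it and [V n k.+2]
   does; hence two mesh steps. *)
have near_up : \forall y \near x, dyadic_height y <= k.+2%:R / 2 ^+ n.
  have [kE|Vx] := pselect (k.+1 = (2 ^ n)%N).
    apply: nearW => y; apply: le_trans (height_le1 y) _.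
    by rewrite ler_pdivlMr ?exprn_gt0// mul1r -natrX -kE ler_nat.
  have k1n : (k.+1 < 2 ^ n)%N by rewrite ltn_neqAle kn andbT; apply/eqP.
  case: up => // {}Vx; have [[W [oW VW WV]] _] := V_nbhd k1n.
  have : open_nbhs x W by split => //; apply: VW; exact: subset_closure.
  by move=> /open_nbhs_nbhs; apply: filterS => y /WV; exact: height_le.
near=> y.
have ylo : k%:R / 2 ^+ n <= dyadic_height y by apply: height_lower => //; near: y.
have yup : dyadic_height y <= k.+2%:R / 2 ^+ n by near: y.
apply: le_trans (ltW ne); rewrite ler_norml.
move: xlo xup ylo yup; rewrite -!natr1 !mulrDl !mul1r mulr2n.
by move: (dyadic_height x) (dyadic_height y) => u v; lra.
Unshelve. all: by end_near.
Qed.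

Lemma dyadic_height_slowly_oscillating : slowly_oscillating L dyadic_height.
Proof.
move=> U LU e /mesh[n ne].
have [K wKV] : exists K, forall k, (k < 2 ^ n)%N ->
    weakly_bounded L (K k) /\ star (V n k) U `<=` V n k.+1 `|` K k.
  have /choice[K hK] : forall k, exists Kk, (k < 2 ^ n)%N ->
      weakly_bounded L Kk /\ star (V n k) U `<=` V n k.+1 `|` Kk.
    move=> k; have [kn|//] := ltnP k (2 ^ n); last by exists set0.
    have [_ /coarse_nbhd_star/(_ LU)[Kk wK VK]] := V_nbhd kn.
    by exists Kk.
  by exists K.
exists (\bigcup_(k < 2 ^ n) K k).
  by apply: weakly_bounded_bigcup => k /wKV[].
move=> B UB BK0.
(* [B] meets [V n k.+1] at [x], so [y] lies in [V n k.+2] or in [K k.+1], and the latter is excluded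
   because [B] avoids all the [K]. Exchanging [x] and [y] bounds the absolute difference. *)
have osc x y : B x -> B y ->
    dyadic_height y <= dyadic_height x + (2 ^+ n)^-1 *+ 2.
  move=> Bx By; have [k [kn lo up]] := bracket n x.
  apply: (@le_trans _ _ (k.+2%:R / 2 ^+ n)); last first.
    have := height_lower kn lo; rewrite -!natr1 !mulrDl !mul1r mulr2n.
    by move: (dyadic_height x) => u; lra.
  have [kE|Vx] := pselect (k.+1 = (2 ^ n)%N).
    apply: le_trans (height_le1 y) _.
    by rewrite ler_pdivlMr ?exprn_gt0// mul1r -natrX -kE ler_nat.
  have k1n : (k.+1 < 2 ^ n)%N by rewrite ltn_neqAle kn andbT; apply/eqP.
  case: up => // {}Vx; apply: height_le => //.
  have [_ /(_ y)] := wKV _ k1n.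
  case=> //; first by exists B => //; split => //; exists x.
  move=> Ky; suff : (set0 : set X) y by [].
  by rewrite -BK0; split => //; exists k.+1.
rewrite /diam; apply: (@le_lt_trans _ _ ((2 ^+ n)^-1 *+ 2)%:E); last first.
  by rewrite lte_fin.
rewrite ge_max lee_fin mulrn_wge0 ?invr_ge0 ?exprn_ge0//=.
apply: ge_ereal_sup => _ [[_ _] [[x Bx <-] [y By <-]] <-] /=.
rewrite lee_fin; change (`|dyadic_height y - dyadic_height x| <= (2 ^+ n)^-1 *+ 2).
rewrite ler_norml; move: (osc _ _ Bx By) (osc _ _ By Bx).
by move: (dyadic_height x) (dyadic_height y) => u v; lra.
Qed.

Lemma dyadic_height_separating :
  separating_map L (V 0 0) (~` V 0 1) dyadic_height.
Proof.
split; [exact: dyadic_height_continuous|exact: dyadic_height_slowly_oscillating|..].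
- by move=> x; rewrite height_ge0 height_le1.
- move=> _ [x Vx <-]; apply/eqP; rewrite eq_le height_ge0 andbT.
  by have := @height_le 0 0 x isT Vx; rewrite mul0r.
- move=> _ [x Vx <-]; apply/eqP; rewrite eq_le height_le1 /=.
  by have := @height_ge 0 1 x isT Vx; rewrite expr0 divr1.
Qed.

End urysohn.

(** * The cycle of implications *)

Lemma hls_normal_urysohn (R : realType) (X : topologicalType)
    (L : hls_structure X) (A N : set X) :
  hls_normal L -> hybrid_nbhd L A N ->
  exists f : X -> R^o, separating_map L A (~` N) f.
Proof.
move=> nL /hybrid_nbhd_closurel AN.
(* A total interpolation function on pairs; [set0] is a dummy value for pairs not admitting
   interpolation. *)
have /choice[mid midP] : forall p : set X * set X, exists M,
    closed p.1 -> hybrid_nbhd L p.1 p.2 ->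
    [/\ closed M, hybrid_nbhd L p.1 M & hybrid_nbhd L M p.2].
  move=> [B M]; have [[cB BM]|nBM] := pselect (closed B /\ hybrid_nbhd L B M).
    by have [W ?] := nL _ _ cB BM; exists W.
  by exists set0 => cB BM; case: nBM.
(* Even indices copy the previous level; odd ones interpolate between their two neighbours. *)
pose V := fix V n := if n is m.+1 then
    fun k => if odd k then mid (V m k./2, V m k./2.+1) else V m k./2
  else fun k => if k == 0%N then closure A else N.
have VP n k : (k < 2 ^ n)%N -> closed (V n k) /\ hybrid_nbhd L (V n k) (V n k.+1).
  elim: n k => [|n IH] k.
    by rewrite expn0 ltnS leqn0 => /eqP -> /=; split => //; exact: closed_closure.
  rewrite expnS mul2n => kn.
  have /IH[cV hV] : (k./2 < 2 ^ n)%N by rewrite ltn_half_double.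
  have [cM VM MV] := midP (V n k./2, V n k./2.+1) cV hV.
  by rewrite /= uphalf_half; case: (odd k).
have [|||cf sf f01 fA fN] := @dyadic_height_separating R X L V.
- by move=> n k _; rewrite /= odd_double doubleK.
- by move=> n k /VP[].
- by move=> n k /VP[].
exists (dyadic_height R V); split => //.
by apply: subset_trans fA; apply: image_subset; exact: subset_closure.
Qed.

Lemma separating_map_nbhd_separated (R : realType) (X : topologicalType)
    (L : hls_structure X) (A B : set X) :
  (forall A N, hybrid_nbhd L A N ->
     exists f : X -> R^o, separating_map L A (~` N) f) ->
  closed A -> closed B -> coarsely_separated L A B -> A `&` B = set0 ->
  exists f : X -> R^o, separating_map L A B f.
Proof.
move=> sep cA cB sAB AB0; rewrite -[B]setCK; apply: sep; split.
  exists (~` B); split => //; first by rewrite openC.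
  by rewrite -(iffLR (closure_id _) cA) -disjoints_subset.
exact: coarsely_separated_nbhd.
Qed.

Lemma slowly_oscillating_dist (X : Type) (L : ls_structure X) (R : realType)
    (f : X -> R^o) (U : set (set X)) (e : R) :
  slowly_oscillating L f -> unif_bounded L U -> 0 < e ->
  exists2 K, weakly_bounded L K & forall B x y,
    U B -> B `&` K = set0 -> B x -> B y -> `|f x - f y| < e.
Proof.
move=> sf LU e0; have [K wK KP] := sf U LU e e0.
exists K => // B x y UB BK Bx By; rewrite -lte_fin.
apply: le_lt_trans (KP B UB BK); rewrite /diam le_max; apply/orP; right.
apply: ereal_sup_ubound; exists (f y, f x) => //.
by split; [exists y|exists x].
Qed.

Lemma separated_maps_hls_normal (R : realType) (X : topologicalType)
    (L : hls_structure X) :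
  (forall A B : set X, closed A -> closed B ->
     coarsely_separated L A B -> A `&` B = set0 ->
     exists f : X -> R^o, separating_map L A B f) ->
  hls_normal L.
Proof.
move=> sep A N cA [[W [oW AW WN]] AN].
have NW : closure (~` N) `<=` ~` W.
  rewrite [X in _ `<=` X](iffLR (closure_id _) _); last by rewrite closedC.
  exact/closureS/subsetC.
have [||f [cf sf f01 fA fN]] := sep A (closure (~` N)) cA (@closed_closure _ _).
- exact/coarsely_separated_closurer/coarse_nbhd_separated.
- rewrite -subset0 => x [Ax /NW]; apply; apply: AW; exact: subset_closure.
have fA0 x : A x -> f x = 0 by move=> Ax; apply: fA; exists x.
have fN1 x : f x < 1 -> N x.
  move=> fx; apply: contrapT => nNx.
  suff fx1 : f x = 1 by rewrite fx1 ltxx in fx.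
  by apply: fN; exists x => //; exact: subset_closure.
have cV : closed [set x | f x <= 2^-1].
  by have /continuous_closedP/(_ _ (@closed_le R 2^-1)) := cf.
have oV (a : R) : open [set x | f x < a].
  by have /continuousP/(_ _ (@open_lt R a)) := cf.
(* Off [K], [f] varies by less than 1/2 on members of [U]; members meeting [K] are absorbed by
   [star K U]. Taking [a] to be 0 and then 1/2 gives the two coarse neighbourhoods. *)
have f_step U B (a : R) : unif_bounded L U -> (forall x, B x -> f x <= a) ->
    exists2 K, weakly_bounded L K & star B U `<=` [set x | f x < a + 2^-1] `|` K.
  move=> LU Ba; have h0 : 0 < 2^-1 :> R by rewrite invr_gt0.
  have [K wK KP] := slowly_oscillating_dist sf LU h0.
  exists (star K U); first exact: weakly_bounded_star.
  move=> x [C [UC [b [Cb Bb]]] Cx].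
  have [CK|/set0P[k [Ck Kk]]] := eqVneq (C `&` K) set0; last first.
    by right; exists C => //; split => //; exists k.
  left => /=; have := KP C x b UC CK Cx Cb; have := Ba b Bb.
  by rewrite ltr_norml => ? /andP[_ ?]; lra.
exists [set x | f x <= 2^-1]; split => //; split.
- exists [set x | f x < 2^-1]; split => //; last by move=> x /ltW.
  by rewrite -(iffLR (closure_id _) cA) => x /fA0 /= ->.
- split=> [x /fA0 /= ->//|U [LU _]].
  have [|K wK AK] := f_step U A 0 LU; first by move=> x /fA0 ->.
  exists K => // x /AK[|]; [left|by right].
  by apply: ltW; rewrite -[2^-1]add0r.
- exists [set x | f x < 1]; split => //.
  by rewrite -(iffLR (closure_id _) cV) => x /= fx; apply: le_lt_trans fx _; lra.
- split=> [x /= fx|U [LU _]]; first by apply: fN1; apply: le_lt_trans fx _; lra.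
  have [//|K wK VK] := f_step U [set x | f x <= 2^-1] 2^-1 LU.
  exists K => // x /VK[/= fx|]; [left|by right].
  by apply: fN1; apply: lt_le_trans fx _; lra.
Qed.

Theorem corollary5p4 (R : realType) (X : topologicalType)
    (L : hls_structure X) :
  [<-> hls_normal L;
       forall A N : set X, hybrid_nbhd L A N ->
         exists f : X -> R^o, separating_map L A (~` N) f;
       forall A B : set X, closed A -> closed B ->
         coarsely_separated L A B -> A `&` B = set0 ->
         exists f : X -> R^o, separating_map L A B f].
Proof.
tfae.
- by move=> nL A N; exact: hls_normal_urysohn.
- by move=> sep A B; exact: separating_map_nbhd_separated.
- exact: separated_maps_hls_normal.
Qed.
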